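(* (i) There exists an (adaptive) algorithm with one-sided error that, given $0<\epsilon<1$, query access to $f\colon[3]\times[n]\to\mathbb{R}$ and sample access to an unknown distribution $\mathcal{D}$ on $[3]\times[n]$, accepts with probability $1$ if $f$ is convex and rejects with probability at least $2/3$ if $f$ is $\epsilon$-far from convex with respect to $\mathcal{D}$, using $O\!\left(\frac{\log^2 n}{\epsilon}\right)$ queries to $f$ and $O\!\left(\frac1\epsilon\right)$ samples from $\mathcal{D}$. (ii) There is a constant $\epsilon_0>0$ such that any non-adaptive $\epsilon_0$-tester for convexity of functions $f\colon[3]\times[n]\to\mathbb{R}$ (in the standard, uniform testing model) has query complexity $\Omega(\sqrt n)$.
   Context: $[m]=\{0,1,\dots,m-1\}$, and $[3]\times[n]\subseteq\mathbb{R}^2$. A function $f\colon X\to\mathbb{R}$ on a finite set $X\subseteq\mathbb{R}^d$ is convex if for every finite collection $x_1,\dots,x_k\in X$ and reals $\lambda_i\ge0$ with $\sum_i\lambda_i=1$ and $\sum_i\lambda_ix_i\in X$, one has $f(\sum_i\lambda_ix_i)\le\sum_i\lambda_if(x_i)$. $g$ is $\epsilon$-far from convex with respect to $\mathcal{D}$ if $\Pr_{x\sim\mathcal{D}}[g(x)\ne h(x)]\ge\epsilon$ for every convex $h$; in the standard model $\mathcal{D}$ is uniform, i.e. $g$ differs from every convex $h$ on at least $\epsilon|X|$ points. An $\epsilon$-tester is a randomized query algorithm accepting convex functions with probability at least $2/3$ and rejecting $\epsilon$-far functions with probability at least $2/3$; it is non-adaptive if all queries are chosen before any value is observed. *)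

(* Defs.v *)
From HB Require Import structures.
From mathcomp Require Import all_boot all_order all_algebra.
From mathcomp Require Import reals exp.
Set Implicit Arguments. Unset Strict Implicit. Unset Printing Implicit Defensive.
Import Order.TTheory GRing.Theory Num.Theory.
Local Open Scope ring_scope.

Section Defs.
Variable R : realType.
Variable n : nat.

Definition pt := ('I_3 * 'I_n)%type.
Definition px (x : pt) : R := (nat_of_ord x.1)%:R.
Definition py (x : pt) : R := (nat_of_ord x.2)%:R.

Definition convex_fun (f : pt -> R) : Prop :=
  forall (s : seq (pt * R)) (y : pt),
    all (fun p => 0 <= p.2) s ->
    \sum_(p <- s) p.2 = 1 ->
    \sum_(p <- s) p.2 * px p.1 = px y ->
    \sum_(p <- s) p.2 * py p.1 = py y ->
    f y <= \sum_(p <- s) p.2 * f p.1.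

Definition is_distr (D : pt -> R) : Prop :=
  (forall x, 0 <= D x) /\ \sum_x D x = 1.

Definition far_wrt (D : pt -> R) (eps : R) (f : pt -> R) : Prop :=
  forall h, convex_fun h -> eps <= \sum_(x | f x != h x) D x.

Definition far_unif (eps : R) (f : pt -> R) : Prop :=
  forall h, convex_fun h -> eps * (#|{: pt}|)%:R <= (#|[pred x : pt | f x != h x]|)%:R.

(* Adaptive randomized algorithms with query access to f, sample access to D,
   and internal uniform random choices. *)
Inductive alg : Type :=
| Ret of bool
| Query of pt & (R -> alg)
| Sample of (pt -> alg)
| Rand (m : nat) of ('I_m.+1 -> alg).

Fixpoint acc (f : pt -> R) (D : pt -> R) (a : alg) : R :=
  match a with
  | Ret b => if b then 1 else 0
  | Query x k => acc f D (k (f x))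
  | Sample k => \sum_x D x * acc f D (k x)
  | Rand m k => (\sum_i acc f D (k i)) / (m.+1)%:R
  end.

Fixpoint within (a : alg) (q s : nat) : Prop :=
  match a with
  | Ret _ => True
  | Query x k => (0 < q)%N /\ forall v, within (k v) q.-1 s
  | Sample k => (0 < s)%N /\ forall x, within (k x) q s.-1
  | Rand m k => forall i, within (k i) q s
  end.

(* A (general, randomized) non-adaptive algorithm making q queries: it draws
   the query tuple Q with probability mu Q, then, after seeing the answers v,
   accepts with probability dec Q v. *)
Definition na_acc (q : nat) (mu : q.-tuple pt -> R)
    (dec : q.-tuple pt -> q.-tuple R -> R) (f : pt -> R) : R :=
  \sum_(Q : q.-tuple pt) mu Q * dec Q (map_tuple f Q).

Definition is_na_tester (eps : R) (q : nat) (mu : q.-tuple pt -> R)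
    (dec : q.-tuple pt -> q.-tuple R -> R) : Prop :=
  [/\ (forall Q, 0 <= mu Q), \sum_Q mu Q = 1,
      (forall Q v, 0 <= dec Q v <= 1),
      (forall f, convex_fun f -> 2 / 3 <= na_acc mu dec f) &
      (forall f, far_unif eps f -> na_acc mu dec f <= 1 / 3)].

End Defs.

(* Main.v *)
Require Import Defs.
From HB Require Import structures.
From mathcomp Require Import all_boot all_order all_algebra.
From mathcomp Require Import zify ring lra.
From mathcomp Require Import boolp reals exp.
Import Order.TTheory GRing.Theory Num.Theory.
Local Open Scope ring_scope.

Set Implicit Arguments.
Unset Strict Implicit.
Unset Printing Implicit Defensive.

(** Part (i).  A sampled point is tested by deterministic adaptive queries, and
    passes when the answers are consistent with some convex function.  A point
    of an outer column queries its path in a binary search tree on the column.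
    Two such paths share a node separating their leaves, so every passing point
    has a tangent slope valid at all passing points of its column; the slope
    across columns can then be taken steep enough.  A point [(1, y)] must find
    one slope [v] and points [a], [b] of the outer columns touched by lines of
    slope [v]; for a convex function these come out of bisections, where the
    candidates for [v] are the two slopes of the middle column at [y] and the
    common slope at the minimizer of [f (0, a) + f (2, b)], [a + b = 2 y].  So
    all passing points have affine minorants, whose maximum is a convex function
    equal to [f] on them; hence a far function fails each round with probability
    at least [eps].

    Part (ii).  Let [z = y + i tau] for a hidden shift [tau].  The convex
    instances are [z ^ 2] plus a bit, where a random seed bit per pair
    [{2 k, 2 k + 1}] decides which of the two carries the bump.  Flipping the
    bits in the middle column violates midpoint convexity once in each pair, but
    is invisible unless some queried middle point and some queried outer point
    lie in the same pair, and each pair of queries achieves that for at most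
    three values of [tau]. *)

(** * Affine functions and convexity on the grid *)

Section ConvexTools.
Variables (R : realType) (n : nat).
Implicit Types f h : pt n -> R.

Definition aff (c u v : R) (z : pt n) : R := c + u * px R z + v * py R z.

Lemma sum_aff (s : seq (pt n * R)) (y : pt n) (c u v : R) :
  \sum_(p <- s) p.2 = 1 ->
  \sum_(p <- s) p.2 * px R p.1 = px R y ->
  \sum_(p <- s) p.2 * py R p.1 = py R y ->
  \sum_(p <- s) p.2 * aff c u v p.1 = aff c u v y.
Proof.
move=> s1 sx sy.
rewrite /aff -sx -sy -[c in RHS]mulr1 -s1 !mulr_sumr -!big_split /=.
by apply: eq_bigr => p _; ring.
Qed.

Lemma supported_convex f :
  (forall x, exists c u v : R,
     aff c u v x = f x /\ forall z, aff c u v z <= f z) ->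
  convex_fun f.
Proof.
move=> sup s y s0 s1 sx sy; have [c [u [v [<- le_f]]]] := sup y.
rewrite -(sum_aff c u v s1 sx sy) !big_seq; apply: ler_sum => p ps.
by apply: ler_wpM2l; [exact: (allP s0) | exact: le_f].
Qed.

(** Dividing the weights by [W] reduces this to [convex_fun]; later combinations can keep natural
    weights such as index differences. *)
Lemma convex_cone f (s : seq (pt n * R)) (y : pt n) (W : R) :
  convex_fun f -> 0 < W -> all (fun p => 0 <= p.2) s ->
  \sum_(p <- s) p.2 = W ->
  \sum_(p <- s) p.2 * px R p.1 = W * px R y ->
  \sum_(p <- s) p.2 * py R p.1 = W * py R y ->
  W * f y <= \sum_(p <- s) p.2 * f p.1.
Proof.
move=> cf W0 s0 sW sx sy.
have sumE (F : pt n -> R) :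
    \sum_(p <- [seq (p.1, p.2 / W) | p <- s]) p.2 * F p.1
    = (\sum_(p <- s) p.2 * F p.1) / W.
  by rewrite big_map mulr_suml; apply: eq_bigr => p _ /=; rewrite mulrAC.
rewrite mulrC -ler_pdivlMr // -sumE; apply: cf.
- by rewrite all_map; apply: sub_all s0 => p /= p0; rewrite divr_ge0 // ltW.
- by rewrite big_map -mulr_suml sW divff // gt_eqF.
- by rewrite sumE sx mulrAC divff ?mul1r // gt_eqF.
- by rewrite sumE sy mulrAC divff ?mul1r // gt_eqF.
Qed.

End ConvexTools.

(** * Convex sequences *)

Section ConvexSequences.
Variable R : realType.
Implicit Types (psi phi : nat -> R).

Definition cvx_seq psi (lo hi : nat) := forall i j k : nat,
  (lo <= i)%N -> (i <= j)%N -> (j <= k)%N -> (k <= hi)%N ->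
  (k%:R - i%:R) * psi j <= (k%:R - j%:R) * psi i + (j%:R - i%:R) * psi k.

Definition subgrad psi (n a : nat) (v : R) :=
  forall z, (z <= n)%N -> psi a + v * (z%:R - a%:R) <= psi z.

Lemma cvx_seqS psi lo hi lo' hi' : (lo <= lo')%N -> (hi' <= hi)%N ->
  cvx_seq psi lo hi -> cvx_seq psi lo' hi'.
Proof.
by move=> le1 le2 c i j k li ij jk kh; apply: c => //; apply: leq_trans; eassumption.
Qed.

Lemma cvx_seq_sub_linear psi lo hi v :
  cvx_seq psi lo hi -> cvx_seq (fun i => psi i - v * i%:R) lo hi.
Proof. by move=> c i j k li ij jk kh; have := c i j k li ij jk kh; lra. Qed.

Lemma cvx_seqD psi phi lo hi : cvx_seq psi lo hi -> cvx_seq phi lo hi ->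
  cvx_seq (fun i => psi i + phi i) lo hi.
Proof.
move=> c d i j k li ij jk kh.
by have := c i j k li ij jk kh; have := d i j k li ij jk kh; lra.
Qed.

(** The bounds select the [i <= n] for which [s - i] is an untruncated difference in [[0, n]]. *)
Lemma cvx_seq_reflect psi n s : cvx_seq psi 0 n ->
  cvx_seq (fun i => psi (s - i)%N) (s - n) (minn n s).
Proof.
move=> c i j k li ij jk kh; have := c (s - k)%N (s - j)%N (s - i)%N.
rewrite !natrB; [|lia..].
by move=> /(_ ltac:(lia) ltac:(lia) ltac:(lia) ltac:(lia)); lra.
Qed.

(** Convexity propagates the two neighbouring slopes to the whole range; at an end of the range one
    condition is void. *)
Lemma subgrad_local psi n a v : cvx_seq psi 0 n -> (a <= n)%N ->
  ((0 < a)%N -> psi a - psi a.-1 <= v) ->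
  ((a < n)%N -> v <= psi a.+1 - psi a) -> subgrad psi n a v.
Proof.
move=> c an lv vr z zn; case: (ltngtP z a) => [za|az|->]; last by rewrite subrr; lra.
- case: a an za c lv {vr} => // a an za c /(_ isT) /= lv.
  have := c z a a.+1 (leq0n _) za (leqnSn _) an.
  have : z%:R <= a%:R :> R by rewrite ler_nat.
  rewrite -natr1; nra.
- have := c a a.+1 z (leq0n _) (leqnSn _) az zn.
  have : a.+1%:R <= z%:R :> R by rewrite ler_nat.
  have := vr (leq_trans az zn); rewrite -natr1; nra.
Qed.

Lemma cvx_slopes psi n c : cvx_seq psi 0 n -> (0 < c)%N -> (c < n)%N ->
  psi c - psi c.-1 <= psi c.+1 - psi c.
Proof.
case: c => // c cc _ cn.
have := cc c c.+1 c.+2 (leq0n _) (leqnSn _) (leqnSn _) cn.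
by rewrite -!natr1 /=; lra.
Qed.

Lemma ex_subgrad psi n a : cvx_seq psi 0 n -> (a <= n)%N ->
  exists v, subgrad psi n a v.
Proof.
move=> c an; have [lt|ge] := boolP (a < n)%N.
  exists (psi a.+1 - psi a); apply: subgrad_local => // a0.
  exact: (cvx_slopes c).
by exists (psi a - psi a.-1); apply: subgrad_local => // lt; rewrite lt in ge.
Qed.

Lemma interpolate (l u : seq R) :
  (forall x y, x \in l -> y \in u -> x <= y) ->
  exists v, (forall x, x \in l -> x <= v) /\ (forall y, y \in u -> v <= y).
Proof.
case: u => [|u0 u] lu.
  exists (\big[Num.max/0]_(x <- l) x); split=> // x xl.
  by apply: bigmax_sup_seq xl _ _.
exists (\big[Num.min/u0]_(y <- u0 :: u) y); split=> [x xl|y yu].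
  rewrite big_seq; apply: le_bigmin => [|y yu]; last exact: lu.
  by apply: lu => //; rewrite inE eqxx.
by apply: bigmin_inf_seq yu _ _.
Qed.

(** Moving [a] and [b] by one unit in opposite directions keeps their sum, so optimality bounds the
    left slope of each sequence by the right slope of the other. The two subdifferentials therefore
    intersect. *)
Lemma common_subgrad psi phi n y a b :
  cvx_seq psi 0 n -> cvx_seq phi 0 n -> (a <= n)%N -> (b <= n)%N ->
  (a + b = y.*2)%N ->
  (forall a' b', (a' <= n)%N -> (b' <= n)%N -> (a' + b' = y.*2)%N ->
     psi a + phi b <= psi a' + phi b') ->
  exists v, subgrad psi n a v /\ subgrad phi n b v.
Proof.
move=> cpsi cphi an bn ab opt.
pose l := (if (0 < a)%N then [:: psi a - psi a.-1] else [::]) ++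
          (if (0 < b)%N then [:: phi b - phi b.-1] else [::]).
pose u := (if (a < n)%N then [:: psi a.+1 - psi a] else [::]) ++
          (if (b < n)%N then [:: phi b.+1 - phi b] else [::]).
have [x y'|v [lv vu]] := interpolate (l := l) (u := u).
  rewrite !mem_cat => /orP[] + /orP[]; case: ifP => // p1; case: ifP => // p2;
    rewrite !inE => /eqP-> /eqP->.
  - exact: (cvx_slopes cpsi).
  - by have := opt a.-1 b.+1 ltac:(lia) ltac:(lia) ltac:(lia); lra.
  - by have := opt a.+1 b.-1 ltac:(lia) ltac:(lia) ltac:(lia); lra.
  - exact: (cvx_slopes cphi).
exists v; split; apply: subgrad_local => // p;
  (apply: lv || apply: vu); by rewrite mem_cat p inE eqxx ?orbT.
Qed.

Lemma subgrad_slope psi n a v (m : nat) : cvx_seq psi 0 n -> subgrad psi n a v ->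
  (a <= n)%N -> (m.+1 <= n)%N ->
  ((a <= m)%N -> v <= psi m.+1 - psi m) /\ ((m < a)%N -> psi m.+1 - psi m <= v).
Proof.
move=> c sv an mn; split=> [am|ma].
- have [e|ne] := eqVneq a m; first by have := sv m.+1 mn; rewrite e -natr1; lra.
  have d0 : 0 < m%:R - a%:R :> R by rewrite subr_gt0 ltr_nat ltn_neqAle ne am.
  have := c a m m.+1 (leq0n _) am (leqnSn _) mn; have := sv m (ltnW mn).
  by rewrite -natr1 => sm cm; rewrite -(ler_pM2l d0); lra.
- have [e|ne] := eqVneq a m.+1; first by have := sv m (ltnW mn); rewrite e -natr1; lra.
  have d0 : 0 < a%:R - m.+1%:R :> R.
    by rewrite subr_gt0 ltr_nat ltn_neqAle eq_sym ne ma.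
  have := c m m.+1 a (leq0n _) (leqnSn _) ma an; have := sv m.+1 mn.
  by move=> sm cm; rewrite -(ler_pM2l d0); rewrite -natr1 in sm cm *; lra.
Qed.

(* The optimal slope without the middle column is clamped to the subdifferential
   of the middle column; if clamping moves it, the side columns are touched
   beyond [a] and [b], where the triangle with the neighbour of [y] applies. *)
Lemma touching_slope (h0 h1 h2 : nat -> R) n y a b al bl ar br :
  cvx_seq h0 0 n -> cvx_seq h1 0 n -> cvx_seq h2 0 n -> (y <= n)%N ->
  (forall (a b m : nat) (t : R), (a <= n)%N -> (b <= n)%N -> (m <= n)%N ->
     0 <= t -> a%:R + b%:R + t * m%:R = (2 + t) * y%:R ->
     (2 + t) * h1 y <= h0 a + h2 b + t * h1 m) ->
  (a <= n)%N -> (b <= n)%N -> (al <= n)%N -> (bl <= n)%N ->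
  (ar <= n)%N -> (br <= n)%N ->
  (a + b = y.*2)%N ->
  (forall a' b', (a' <= n)%N -> (b' <= n)%N -> (a' + b' = y.*2)%N ->
     h0 a + h2 b <= h0 a' + h2 b') ->
  subgrad h0 n al (h1 y - h1 y.-1) -> subgrad h2 n bl (h1 y - h1 y.-1) ->
  subgrad h0 n ar (h1 y.+1 - h1 y) -> subgrad h2 n br (h1 y.+1 - h1 y) ->
  exists v a' b', [/\ (a', b') \in [:: (a, b); (al, bl); (ar, br)],
    subgrad h0 n a' v, subgrad h1 n y v, subgrad h2 n b' v &
    2 * (h1 y - v * y%:R) <= (h0 a' - v * a'%:R) + (h2 b' - v * b'%:R)].
Proof.
move=> c0 c1 c2 yn tri an bn aln bln arn brn ab opt sal sbl sar sbr.
have [w [sa sb]] := common_subgrad c0 c2 an bn ab opt.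
have abR : a%:R + b%:R = 2 * y%:R :> R by rewrite -natrD ab -mul2n natrM.
have slopes := cvx_slopes (c := y) c1.
have [/andP[y0 wl]|nl] := boolP ((0 < y)%N && (w < h1 y - h1 y.-1)).
  exists (h1 y - h1 y.-1), al, bl; split => //; first by rewrite !inE eqxx orbT.
    by apply: subgrad_local => // yn'; exact: slopes.
  have y1 : y.-1%:R = y%:R - 1 :> R by rewrite -subn1 natrB.
  have a_al : a%:R <= al%:R :> R.
    by have := sal a an; have := sa al aln; nra.
  have b_bl : b%:R <= bl%:R :> R.
    by have := sbl b bn; have := sb bl bln; nra.
  (* The weight on [y.-1] brings the barycentre back to [y]; it is nonnegative because the touching
     points moved right. *)
  have := tri al bl y.-1 (al%:R + bl%:R - 2 * y%:R) aln bln.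
  by move=> /(_ ltac:(lia) ltac:(lra)); rewrite y1 => /(_ ltac:(ring)); lra.
have [/andP[yn' wr]|nr] := boolP ((y < n)%N && (h1 y.+1 - h1 y < w)).
  exists (h1 y.+1 - h1 y), ar, br; split => //; first by rewrite !inE eqxx !orbT.
    by apply: subgrad_local => // y0; exact: slopes.
  have a_ar : ar%:R <= a%:R :> R.
    by have := sar a an; have := sa ar arn; nra.
  have b_br : br%:R <= b%:R :> R.
    by have := sbr b bn; have := sb br brn; nra.
  have := tri ar br y.+1 (2 * y%:R - ar%:R - br%:R) arn brn.
  by move=> /(_ ltac:(lia) ltac:(lra)); rewrite -natr1 => /(_ ltac:(ring)); lra.
(* No clamping occurs, so [w] is a subgradient of the middle column too, and midpoint convexity
   (weight [0]) suffices. *)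
exists w, a, b; split => //; first by rewrite inE eqxx.
  apply: subgrad_local => // p; rewrite p /= -leNgt in nl nr *; assumption.
by have := tri a b y 0 an bn yn (lexx _) ltac:(lra); nra.
Qed.

End ConvexSequences.

(* Split points on the way to the leaf [a] of the binary tree on [0, 2 ^ k). *)
Fixpoint mids (k a : nat) : seq nat :=
  if k is k'.+1 then (a./2).*2.+1 :: [seq m.*2 | m <- mids k' a./2] else [::].

Lemma size_mids k a : size (mids k a) = k.
Proof. by elim: k a => //= k IHk a; rewrite size_map IHk. Qed.

(** Siblings [2c] and [2c + 1] are separated by the split point [2c + 1]; otherwise a split of the
    halves, doubled, separates [a] and [x]. *)
Lemma mids_separate k a x : (a < x)%N -> (x < 2 ^ k)%N ->
  exists m, [/\ (a < m)%N, (m <= x)%N, m \in mids k a & m \in mids k x].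
Proof.
elim: k a x => [|k IHk] a x ax; first by rewrite expn0; lia.
rewrite expnS => xk /=.
have [e|ne] := eqVneq a./2 x./2.
  by exists (a./2).*2.+1; rewrite -e !inE eqxx; split => //; lia.
have [m [am mx ma mx']] := IHk a./2 x./2 ltac:(lia) ltac:(lia).
exists m.*2; rewrite !inE !map_f ?orbT //; split => //; lia.
Qed.

(** * Adaptive query programs *)

Section Programs.
Variables (R : realType) (n : nat).
Local Notation point := (pt n.+1).
Implicit Types (f h : point -> R).

(** Only queries occur here, so the points visited depend on [f] alone; [compile] adds the verdict
    and [rounds] the samples. *)
Inductive prog (T : Type) : Type :=
| Done of T
| Ask of point & (R -> prog T).

Fixpoint bind T U (p : prog T) (k : T -> prog U) : prog U :=
  match p with
  | Done t => k t
  | Ask x c => Ask x (fun v => bind (c v) k)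
  end.

Definition ask (x : point) : prog R := Ask x (@Done R).

Fixpoint askall (s : seq point) : prog unit :=
  if s is x :: s' then Ask x (fun=> askall s') else Done tt.

Fixpoint run T f (p : prog T) : T :=
  match p with Done t => t | Ask x c => run f (c (f x)) end.

Fixpoint trace T f (p : prog T) : seq point :=
  match p with Done _ => [::] | Ask x c => x :: trace f (c (f x)) end.

Fixpoint cost T (p : prog T) (d : nat) : Prop :=
  match p with
  | Done _ => True
  | Ask _ c => if d is d'.+1 then forall v, cost (c v) d' else False
  end.

Lemma run_bind T U f (p : prog T) (k : T -> prog U) :
  run f (bind p k) = run f (k (run f p)).
Proof. by elim: p => //= x c IH; exact: IH. Qed.

Lemma trace_bind T U f (p : prog T) (k : T -> prog U) :
  trace f (bind p k) = trace f p ++ trace f (k (run f p)).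
Proof. by elim: p => //= x c IH; rewrite IH. Qed.

Lemma mem_trace_bind T U f (p : prog T) (k : T -> prog U) z :
  z \in trace f (k (run f p)) -> z \in trace f (bind p k).
Proof. by rewrite trace_bind mem_cat => ->; rewrite orbT. Qed.

Lemma trace_askall f s : trace f (askall s) = s.
Proof. by elim: s => //= x s ->. Qed.

(** By determinism, a run on an arbitrary [f] can be analysed as a run on any convex function
    consistent with its answers. *)
Lemma eq_trace T f h (p : prog T) :
  (forall z, z \in trace f p -> h z = f z) -> trace h p = trace f p.
Proof.
elim: p => //= x c IH fh; rewrite fh ?inE ?eqxx // IH // => z zt.
by apply: fh; rewrite inE zt orbT.
Qed.

Lemma cost_le T (p : prog T) d d' : (d <= d')%N -> cost p d -> cost p d'.
Proof.
elim: p d d' => //= x c IH [//|d] [//|d'] dd' cd v.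
exact: IH (cd v).
Qed.

Lemma cost_bind T U (p : prog T) (k : T -> prog U) d e :
  cost p d -> (forall t, cost (k t) e) -> cost (bind p k) (d + e).
Proof.
move=> + ck; elim: p d => [t|x c IH] /= d; last first.
  by case: d => //= d cd v; exact: IH.
by move=> _; apply: cost_le (ck t); rewrite leq_addl.
Qed.

Lemma cost_askall s : cost (askall s) (size s).
Proof. by elim: s => //= x s IHs. Qed.

(** * Bisection for a minimizer *)

Fixpoint argmin (phi : nat -> prog R) (k lo hi : nat) : prog nat :=
  if k is k'.+1 then
    if (lo < hi)%N then
      bind (phi (lo + hi)./2) (fun s =>
      bind (phi (lo + hi)./2.+1) (fun t =>
      if t < s then argmin phi k' (lo + hi)./2.+1 hi
      else argmin phi k' lo (lo + hi)./2))
    else Done lo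
  else Done lo.

Lemma cost_argmin phi d k lo hi : (forall i, cost (phi i) d) ->
  cost (argmin phi k lo hi) (k * d.*2).
Proof.
move=> cphi; elim: k lo hi => //= k IHk lo hi; case: ifP => // _.
rewrite mulSn -addnn -addnA.
apply: cost_bind => // s; apply: cost_bind => // t.
by case: ifP => _; rewrite addnn.
Qed.

(** By convexity, comparing two neighbouring values shows on which side a minimizer lies; a tie
    keeps the left half, whose last point is then no worse than anything to its right. The number
    [k] is fuel. *)
Lemma run_argmin f phi k lo hi :
  cvx_seq (fun i => run f (phi i)) lo hi -> (lo <= hi)%N -> (hi - lo < 2 ^ k)%N ->
  (lo <= run f (argmin phi k lo hi) <= hi)%N /\
  (forall i, (lo <= i)%N -> (i <= hi)%N ->
     run f (phi (run f (argmin phi k lo hi))) <= run f (phi i)).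
Proof.
elim: k lo hi => [|k IHk] lo hi cv lh /=.
  rewrite expn0 => hl; have -> : hi = lo by lia.
  by split=> [|i i1 i2]; [lia | have -> : i = lo by lia].
rewrite expnS => hl; case: ifP => [lt|]; last first.
  move=> ge; have -> : hi = lo by lia.
  by split=> [|i i1 i2]; [rewrite /=; lia | have -> : i = lo by lia].
set m := (lo + hi)./2; have lm : (lo <= m)%N by rewrite /m; lia.
have mh : (m < hi)%N by rewrite /m; lia.
rewrite !run_bind; case: ifP => [dec|].
  have [||rng opt] := IHk m.+1 hi (cvx_seqS (leqW lm) (leqnn _) cv); [lia..|].
  split=> [|i i1 i2]; first lia.
  have [im|mi] := leqP i m; last exact: opt.
  apply: le_trans (opt m.+1 _ _) _ => //.
  have := cv i m m.+1 i1 im (leqnSn _) mh.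
  have : i%:R <= m%:R :> R by rewrite ler_nat.
  by rewrite -natr1; nra.
move=> /negbT; rewrite -leNgt => inc.
have [||rng opt] := IHk lo m (cvx_seqS (leqnn _) (ltnW mh) cv); [rewrite /m; lia..|].
split=> [|i i1 i2]; first lia.
have [im|mi] := leqP i m; first exact: opt.
apply: le_trans (opt m _ _) _ => //.
have := cv m m.+1 i lm (leqnSn _) mi i2.
have : m.+1%:R <= i%:R :> R by rewrite ler_nat.
by rewrite -natr1; nra.
Qed.

(** * Columns and their search paths *)

Definition pnt (i a : nat) : point := (inord i, inord a).

Definition col h (i a : nat) : R := h (pnt i a).

Lemma pntK (z : point) : pnt z.1 z.2 = z.
Proof. by case: z => i a; rewrite /pnt !inord_val. Qed.

Lemma px_pnt i a : (i < 3)%N -> px R (pnt i a) = i%:R.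
Proof. by move=> i3; rewrite /px /= inordK. Qed.

Lemma py_pnt i a : (a <= n)%N -> py R (pnt i a) = a%:R.
Proof. by move=> an; rewrite /py /= inordK. Qed.

Lemma col_cvx h i : convex_fun h -> (i < 3)%N -> cvx_seq (col h i) 0 n.
Proof.
move=> ch i3 a b c _ ab bc cn.
have [e|ne] := eqVneq a c; first by rewrite (_ : b = c) ?e; [lra | lia].
have := @convex_cone R n.+1 h
  [:: (pnt i a, c%:R - b%:R); (pnt i c, b%:R - a%:R)] (pnt i b) (c%:R - a%:R) ch.
rewrite !big_cons !big_nil /= !px_pnt // !py_pnt; [|lia..].
rewrite subr_gt0 ltr_nat !subr_ge0 !ler_nat ab bc ltn_neqAle ne (leq_trans ab bc).
by move=> /(_ isT isT ltac:(ring) ltac:(ring) ltac:(ring)); rewrite /col; lra.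
Qed.

Lemma convex_triangle h y (a b m : nat) (t : R) : convex_fun h -> (y <= n)%N ->
  (a <= n)%N -> (b <= n)%N -> (m <= n)%N ->
  0 <= t -> a%:R + b%:R + t * m%:R = (2 + t) * y%:R ->
  (2 + t) * col h 1 y <= col h 0 a + col h 2 b + t * col h 1 m.
Proof.
move=> ch yn an bn mn t0 e.
have := @convex_cone R n.+1 h
  [:: (pnt 0 a, 1); (pnt 2 b, 1); (pnt 1 m, t)] (pnt 1 y) (2 + t) ch.
rewrite !big_cons !big_nil /= !px_pnt // !py_pnt // t0 ler01 /=.
move=> /(_ ltac:(lra) isT ltac:(ring) ltac:(ring)); rewrite /col.
by move=> /(_ ltac:(lra)); lra.
Qed.

Definition height := up_log 2 n.+1.

Lemma height_ge : (n < 2 ^ height)%N.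
Proof. exact: up_logP. Qed.

(** The pair [m.-1], [m] reveals the slope across the split [m]. Splits above [n] wrap around, but a
    split separating two points of the column never exceeds the larger one. *)
Definition search_path (i a : nat) : seq point :=
  pnt i a :: flatten [seq [:: pnt i m.-1; pnt i m] | m <- mids height a].

Lemma size_path i a : size (search_path i a) = (height.*2).+1.
Proof.
rewrite /search_path /= size_flatten /shape -map_comp /=; congr _.+1.
by rewrite -[in RHS](size_mids height a); elim: (mids _ _) => //= m s ->; lia.
Qed.

Lemma mem_path i a m : m \in mids height a ->
  (pnt i m.-1 \in search_path i a) /\ (pnt i m \in search_path i a).
Proof.
move=> ma; split; rewrite inE; apply/orP; right; apply/flattenP;
  exists [:: pnt i m.-1; pnt i m]; rewrite ?inE ?eqxx ?orbT //;
  exact: map_f ma.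
Qed.

Definition fits f (s : seq point) h := forall z, z \in s -> h z = f z.

(* The search paths of [a] and [x] share a node [m] separating them; the slope
   of [f] at [m] is compared with [v] on the side of [a], and bounds [f x] on
   the side of [x]. *)
Lemma path_subgrad f h h' i a x v : (i < 3)%N -> (a <= n)%N -> (x <= n)%N ->
  convex_fun h -> convex_fun h' ->
  fits f (search_path i a) h -> fits f (search_path i x) h' ->
  subgrad (col h i) n a v -> col f i a + v * (x%:R - a%:R) <= col f i x.
Proof.
move=> i3 an xn ch ch' fh fh' sv.
have fa : col h i a = col f i a by apply: fh; rewrite inE eqxx.
have fx : col h' i x = col f i x by apply: fh'; rewrite inE eqxx.
have nh := height_ge.
have [ax|xa|->] := ltngtP a x; last by rewrite subrr; lra.
- have [m1 []] := mids_separate ax (leq_ltn_trans xn nh).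
  case: m1 => // m am mx ma mx'.
  have [/fh + /fh] := mem_path i ma; have [/fh' + /fh'] := mem_path i mx'.
  rewrite /= -/(col h i m) -/(col h i m.+1) -/(col h' i m) -/(col h' i m.+1).
  rewrite -/(col f i m) -/(col f i m.+1) => e1 e2 e3 e4.
  have [/(_ am) + _] := subgrad_slope (m := m) (col_cvx ch i3) sv an ltac:(lia).
  have := sv m ltac:(lia).
  have := col_cvx ch' i3 (leq0n m) (leqnSn m) mx xn.
  rewrite e1 e2 e3 e4 fa fx.
  have : m.+1%:R <= x%:R :> R by rewrite ler_nat.
  by rewrite -natr1; nra.
- have [m1 []] := mids_separate xa (leq_ltn_trans an nh).
  case: m1 => // m am mx ma mx'.
  have [/fh + /fh] := mem_path i mx'; have [/fh' + /fh'] := mem_path i ma.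
  rewrite /= -/(col h i m) -/(col h i m.+1) -/(col h' i m) -/(col h' i m.+1).
  rewrite -/(col f i m) -/(col f i m.+1) => e1 e2 e3 e4.
  have [_ /(_ mx)] := subgrad_slope (m := m) (col_cvx ch i3) sv an ltac:(lia).
  have := sv m.+1 ltac:(lia).
  have := col_cvx ch' i3 (leq0n x) am (leqnSn m) ltac:(lia).
  rewrite e1 e2 e3 e4 fa fx.
  have : x%:R <= m%:R :> R by rewrite ler_nat.
  by rewrite -natr1; nra.
Qed.

(** * Queries made at a sampled point *)

Definition tilted (i : nat) (v : R) : prog nat :=
  argmin (fun a => bind (ask (pnt i a)) (fun w => Done (w - v * a%:R))) height 0 n.

Definition balanced (s : nat) : prog nat :=
  argmin (fun a => bind (ask (pnt 0 a)) (fun v =>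
                   bind (ask (pnt 2 (s - a))) (fun w => Done (v + w))))
    height (s - n) (minn n s).

(* For [y = n] the query at [y.+1] wraps around; its answer only steers a search
   whose outcome is then not needed. *)
Definition middle_strategy (y : nat) : prog unit :=
  bind (balanced y.*2) (fun a =>
  bind (ask (pnt 1 y)) (fun c =>
  bind (ask (pnt 1 y.-1)) (fun l =>
  bind (ask (pnt 1 y.+1)) (fun r =>
  bind (tilted 0 (c - l)) (fun al =>
  bind (tilted 2 (c - l)) (fun bl =>
  bind (tilted 0 (r - c)) (fun ar =>
  bind (tilted 2 (r - c)) (fun br =>
  askall (search_path 1 y ++ flatten [seq search_path 0 p.1 ++ search_path 2 p.2 |
            p <- [:: (a, y.*2 - a); (al, bl); (ar, br)]%N]))))))))).

Definition strategy (x : point) : prog unit :=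
  if x.1 == 1%N :> nat then middle_strategy x.2 else askall (search_path x.1 x.2).

Lemma cost_strategy x : cost (strategy x) (26 * height + 10).
Proof.
have cost_tilted i v : cost (tilted i v) (height * 2) by apply: (@cost_argmin _ 1).
rewrite /strategy; case: ifP => _; last first.
  by apply: cost_le (cost_askall _); rewrite size_path; lia.
(* The summands are the balanced search, three single queries, four tilted searches and seven search
   paths of length [2 * height + 1]. *)
have -> : (26 * height + 10 = height * 4 + (1 + (1 + (1 + (height * 2 +
   (height * 2 + (height * 2 + (height * 2 + (14 * height + 7)))))))))%N by lia.
apply: cost_bind => [|a]; first by apply: (@cost_argmin _ 2).
do 3! (apply: cost_bind => // ?); do 4! (apply: cost_bind => // ?).
apply: cost_le (cost_askall _).
have sz p : size (search_path 0 p.1 ++ search_path 2 p.2) = (4 * height + 2)%N.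
  by rewrite size_cat !size_path; lia.
by rewrite size_cat size_path size_flatten /shape -map_comp (eq_map sz) /=; lia.
Qed.

Lemma run_tilted h i v : convex_fun h -> (i < 3)%N ->
  (run h (tilted i v) <= n)%N /\ subgrad (col h i) n (run h (tilted i v)) v.
Proof.
move=> ch i3.
have [||] := @run_argmin h (fun a => bind (ask (pnt i a)) (fun w => Done (w - v * a%:R)))
  height 0 n (cvx_seq_sub_linear v (col_cvx ch i3)) => //.
  by rewrite subn0 height_ge.
rewrite -/(tilted i v) => /andP[_ le_n] opt; split=> // z zn.
by have := opt z (leq0n z) zn; rewrite /= -!/(col _ _ _); lra.
Qed.

Lemma run_balanced h y : convex_fun h -> (y <= n)%N ->
  let a := run h (balanced y.*2) in let b := (y.*2 - a)%N in
  [/\ (a <= n)%N, (b <= n)%N, (a + b = y.*2)%N &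
    forall a' b', (a' <= n)%N -> (b' <= n)%N -> (a' + b' = y.*2)%N ->
     col h 0 a + col h 2 b <= col h 0 a' + col h 2 b'].
Proof.
move=> ch yn a b; pose s := y.*2.
have cv : cvx_seq (fun a => col h 0 a + col h 2 (s - a)%N) (s - n) (minn n s).
  apply: cvx_seqD; last exact: cvx_seq_reflect (col_cvx ch _).
  by apply: cvx_seqS (col_cvx ch (isT : (0 < 3)%N)) => //; rewrite geq_minl.
have [||] := @run_argmin h (fun a => bind (ask (pnt 0 a)) (fun v =>
                   bind (ask (pnt 2 (s - a))) (fun w => Done (v + w))))
  height (s - n) (minn n s) cv.
- by rewrite /s; lia.
- by have := height_ge; rewrite /s; lia.
rewrite -/(balanced s) -/a => rng opt; split; [rewrite /b; lia..|].
move=> a' b' an bn e; have := opt a'; rewrite /= -!/(col _ _ _) -/b.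
have -> : b' = (s - a')%N by lia.
by apply; lia.
Qed.

Lemma middle_strategy_spec h y : convex_fun h -> (y <= n)%N ->
  exists v a b, [/\ (a <= n)%N, (b <= n)%N,
    {subset search_path 1 y ++ search_path 0 a ++ search_path 2 b <= trace h (middle_strategy y)},
    [/\ subgrad (col h 0) n a v, subgrad (col h 1) n y v & subgrad (col h 2) n b v] &
    2 * (col h 1 y - v * y%:R) <=
      (col h 0 a - v * a%:R) + (col h 2 b - v * b%:R)].
Proof.
move=> ch yn.
have [an bn ab opt] := run_balanced ch yn.
have [aln sal] := run_tilted (col h 1 y - col h 1 y.-1) ch (isT : (0 < 3)%N).
have [bln sbl] := run_tilted (col h 1 y - col h 1 y.-1) ch (isT : (2 < 3)%N).
have [arn sar] := run_tilted (col h 1 y.+1 - col h 1 y) ch (isT : (0 < 3)%N).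
have [brn sbr] := run_tilted (col h 1 y.+1 - col h 1 y) ch (isT : (2 < 3)%N).
have tri a b m t := convex_triangle (a := a) (b := b) (m := m) (t := t) ch yn.
have cv i : (i < 3)%N -> cvx_seq (col h i) 0 n := col_cvx ch.
have [v [a' [b' [mem s0 s1 s2 le2]]]] := touching_slope (cv 0%N isT) (cv 1%N isT)
  (cv 2%N isT) yn tri an bn aln bln arn brn ab opt sal sbl sar sbr.
exists v, a', b'; split=> //.
- by move: mem; rewrite !inE => /or3P[] /eqP[-> _].
- by move: mem; rewrite !inE => /or3P[] /eqP[_ ->].
move=> z zin; do 8! apply: mem_trace_bind; rewrite trace_askall.
move: zin; rewrite mem_cat [in X in _ -> X]mem_cat => /orP[->//|zin].
by apply/orP; right; apply/flatten_mapP; exists (a', b').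
Qed.

(** * Passing points and their affine minorants *)

(** A convex [f] passes everywhere with itself as witness, which gives one-sided error. *)
Definition passes f (x : point) :=
  exists h, convex_fun h /\ fits f (trace f (strategy x)) h.

(** The middle strategy also queries the path of its own point, so [path_subgrad] applies to passing
    points of every column. *)
Lemma passes_path f x : passes f x ->
  exists h, convex_fun h /\ fits f (search_path x.1 x.2) h.
Proof.
case=> h [ch fh]; exists h; split=> //.
have := fh; rewrite -(eq_trace fh) {fh} /strategy.
case: eqP => [e|_]; last by rewrite trace_askall.
have [v [a [b [_ _ sub _ _]]]] := middle_strategy_spec ch (ltn_ord x.2 : (x.2 <= n)%N).
by move=> fh z zin; apply: fh; apply: sub; rewrite e in zin; rewrite mem_cat zin.
Qed.

Lemma passes_support f x : passes f x ->
  exists c u v, aff c u v x = f x /\ forall z, passes f z -> aff c u v z <= f z.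
Proof.
have yn (z : point) : (z.2 <= n)%N by exact: (ltn_ord z.2).
have fE (z : point) i : z.1 = i :> nat -> f z = col f i z.2.
  by move=> <-; rewrite /col pntK.
case=> h [ch fh]; have := fh; rewrite -(eq_trace fh) {fh} /strategy.
case: eqP => [e|/eqP ne]; last first.
  rewrite trace_askall => fh.
  have [v sv] := ex_subgrad (col_cvx ch (ltn_ord x.1)) (yn x).
  (* [M] dominates every deviation of [f] from the tangent, and the sign of [1 - px R x] makes [u]
     descend away from the outer column of [x]. *)
  pose M := \sum_(z : point) `|f z - f x - v * (py R z - py R x)|.
  pose u := - M * (1 - px R x).
  exists (f x - u * px R x - v * py R x), u, v.
  split=> [|z /passes_path [h' [ch' fh']]]; first by rewrite /aff; ring.
  have [ez|nz] := eqVneq (z.1 : nat) (x.1 : nat).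
    rewrite ez in fh'.
    have := path_subgrad (ltn_ord _) (yn x) (yn z) ch ch' fh fh' sv.
    rewrite -(fE _ _ erefl) -(fE _ _ ez) /aff /px ez /py; lra.
  have side : 1 <= (1 - px R x) * (px R z - px R x).
    rewrite /px; case: (x.1) ne nz => -[|[|[|i]]] //= _ _;
    by case: (z.1) => -[|[|[|j]]] //= _ _; lra.
  have M0 : `|f z - f x - v * (py R z - py R x)| <= M.
    by rewrite /M (bigD1 z) //= lerDl sumr_ge0.
  have M1 : 0 <= M by rewrite sumr_ge0.
  have uM : u * (px R z - px R x) <= - M by rewrite /u -mulrA; nra.
  have := ler_norm (- (f z - f x - v * (py R z - py R x))); rewrite normrN.
  by rewrite /aff; lra.
move=> fh.
have [v [a [b [an bn sub [s0 s1 s2] le2]]]] := middle_strategy_spec ch (yn x).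
have fhx : fits f (search_path 1 x.2) h by move=> z zin; rewrite fh // sub // mem_cat zin.
have fha : fits f (search_path 0 a) h.
  by move=> z zin; rewrite fh // sub // !mem_cat zin orbT.
have fhb : fits f (search_path 2 b) h.
  by move=> z zin; rewrite fh // sub // !mem_cat zin !orbT.
have e1 : col h 1 x.2 = col f 1 x.2 by apply: fhx; rewrite inE eqxx.
have e0 : col h 0 a = col f 0 a by apply: fha; rewrite inE eqxx.
have e2 : col h 2 b = col f 2 b by apply: fhb; rewrite inE eqxx.
rewrite e0 e1 e2 in le2.
(* The plane extends the tangents of slope [v] at [(0, a)] and at [x]; [le2] keeps it on or below
   the tangent at [(2, b)]. *)
pose c := col f 0 a - v * a%:R.
exists c, (col f 1 x.2 - v * x.2%:R - c), v.
split=> [|z /passes_path [h' [ch' fh']]].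
  by rewrite (fE _ _ e) /aff /px e /py; ring.
have zcol i : z.1 = i :> nat -> fits f (search_path i z.2) h' by move=> <-.
rewrite /aff /px /py.
case: (z.1) (ltn_ord z.1) (fE z) zcol => -[|[|[|i]]] //= _ _ /(_ _ erefl) -> /(_ _ erefl) fhz.
- have := path_subgrad _ an (yn z) ch ch' fha fhz s0; rewrite /c => /(_ isT); lra.
- have := path_subgrad _ (yn x) (yn z) ch ch' fhx fhz s1; rewrite /c => /(_ isT); lra.
- have := path_subgrad _ bn (yn z) ch ch' fhb fhz s2; rewrite /c => /(_ isT).
  by rewrite /c in le2 *; lra.
Qed.

Lemma convex_on_passing f :
  exists h, convex_fun h /\ forall x, passes f x -> h x = f x.
Proof.
have /choice[g gP] : forall x, exists p : R * R * R, passes f x ->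
    aff p.1.1 p.1.2 p.2 x = f x /\ forall z, passes f z -> aff p.1.1 p.1.2 p.2 z <= f z.
  move=> x; have [px|npx] := pselect (passes f x); last by exists (0, 0, 0) => /npx.
  by have [c [u [v s]]] := passes_support px; exists (c, u, v).
pose l (x y : point) : R := aff (g x).1.1 (g x).1.2 (g x).2 y.
(* [- M] is at most every value of [f], so as default of the maximum it does no harm at passing
   points, and it covers the case that no point passes. *)
pose M : R := \sum_(z : point) `|f z|.
pose hull y : R := \big[Num.max/- M]_(x | `[< passes f x >]) l x y.
exists hull; split.
  move=> s y s0 s1 sx sy.
  have le_s (k : point -> R) : (forall z, k z <= hull z) ->
      \sum_(p <- s) p.2 * k p.1 <= \sum_(p <- s) p.2 * hull p.1.
    move=> kl; rewrite !big_seq; apply: ler_sum => p ps.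
    by apply: ler_wpM2l; [exact: (allP s0) | exact: kl].
  apply: bigmax_le => [|x px].
    rewrite -[leLHS]mul1r -s1 mulr_suml; apply: (le_s (fun=> - M)) => z.
    exact: bigmax_ge_id.
  rewrite /l -(sum_aff _ _ _ s1 sx sy); apply: le_s => z.
  exact: (le_bigmax_cond _ (fun x => l x z)).
move=> x px; apply/eqP; rewrite eq_le; apply/andP; split.
  apply: bigmax_le => [|z /asboolP pz]; last exact: (gP z pz).2.
  have : `|f x| <= M by rewrite /M (bigD1 x) //= lerDl sumr_ge0.
  by have := ler_norm (- f x); rewrite normrN; lra.
rewrite -[leLHS](gP x px).1.
by apply: (le_bigmax_cond _ (fun z => l z x)); apply/asboolP.
Qed.

(* [C] accumulates the constraints put on a candidate convex function by the
   answers seen so far. *)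
Fixpoint compile (p : prog unit) (C : (point -> R) -> Prop) (next : alg R n.+1) :=
  match p with
  | Done _ => if `[< exists h, C h >] then next else Ret R n.+1 false
  | Ask x c => Query x (fun v => compile (c v) (fun h => C h /\ h x = v) next)
  end.

Lemma acc_compile f D p C next :
  acc f D (compile p C next) =
  if `[< exists h, C h /\ fits f (trace f p) h >] then acc f D next else 0.
Proof.
elim: p C => [t|x c IH] C /=.
  have -> : `[< exists h, C h /\ fits f [::] h >] = `[< exists h, C h >].
    by apply: asbool_equiv_eq; split=> -[h]; [case=> ? _|]; exists h.
  by case: ifP.
rewrite IH; congr (if _ then _ else _); apply: asbool_equiv_eq.
split=> -[h].
  case=> -[ch hx] fh; exists h; split=> // z; rewrite inE => /orP[/eqP->//|].
  exact: fh.
case=> ch fh; exists h; split; first by split=> //; apply: fh; rewrite inE eqxx.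
by move=> z zt; apply: fh; rewrite inE zt orbT.
Qed.

Lemma within_leq (a : alg R n.+1) q q' s : (q <= q')%N -> within a q s -> within a q' s.
Proof.
elim: a q q' s => [b|x c IH|c IH|m c IH] //= q q' s qq'.
- case=> q0 w; split=> [|v]; first exact: leq_trans qq'.
  by apply: IH (w v); lia.
- by case=> s0 w; split=> // x; exact: IH (w x).
- by move=> w i; exact: IH (w i).
Qed.

Lemma within_compile p C next d q s :
  cost p d -> within next q s -> within (compile p C next) (d + q) s.
Proof.
elim: p C d => [t|x c IH] C d /=.
  by case: ifP => // _ _; apply: within_leq; rewrite leq_addl.
by case: d => // d cd w; split=> // v; exact: IH.
Qed.

Fixpoint rounds (s : nat) : alg R n.+1 :=
  if s is s'.+1 then
    Sample (fun x => compile (strategy x) (@convex_fun R n.+1) (rounds s'))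
  else Ret R n.+1 true.

Lemma acc_rounds f D s :
  acc f D (rounds s) = (\sum_x D x * `[< passes f x >]%:R) ^+ s.
Proof.
elim: s => [|s IHs] //=; rewrite exprS mulr_suml; apply: eq_bigr => x _.
by rewrite acc_compile IHs -mulrA; case: asboolP => _; rewrite ?mul1r ?mul0r.
Qed.

Lemma within_rounds s : within (rounds s) (s * (26 * height + 10)) s.
Proof.
elim: s => //= s IHs; split=> // x; rewrite mulSn.
exact: within_compile (cost_strategy x) IHs.
Qed.

Lemma rounds_complete f D s : is_distr D -> convex_fun f -> acc f D (rounds s) = 1.
Proof.
move=> [_ D1] cf; rewrite acc_rounds.
rewrite (eq_bigr D) ?D1 ?expr1n // => x _; rewrite asboolT ?mulr1 //.
by exists f.
Qed.

(** With pass probability [p <= 1 - eps], the product [p ^+ s * (1 + eps) ^+ s] is at most [1],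
    while Bernoulli's inequality gives [(1 + eps) ^+ s >= 3]. *)
Lemma rounds_sound f D (eps : R) s : is_distr D -> 0 < eps < 1 ->
  2 <= s%:R * eps -> far_wrt D eps f -> acc f D (rounds s) <= 1 / 3.
Proof.
move=> [D0 D1] /andP[e0 e1] se far; rewrite acc_rounds.
have [h [ch hf]] := convex_on_passing f.
set p := \sum_x _; have p0 : 0 <= p by apply: sumr_ge0 => x _; rewrite mulr_ge0.
have ple : p <= 1 - eps.
  rewrite lerBrDr; apply: le_trans (lerD (lexx p) (far h ch)) _.
  rewrite /p -[leRHS]D1 [X in _ + X <= _]big_mkcond -big_split /=; apply: ler_sum => x _.
  have := D0 x; case: asboolP => [/hf->|_]; first by rewrite eqxx mulr1 addr0.
  by rewrite mulr0; case: ifP => _; lra.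
have bern : 1 + s%:R * eps <= (1 + eps) ^+ s.
  elim: s {se} => [|s IHs]; first by rewrite mul0r addr0 expr0.
  by rewrite exprS -natr1; have := ler0n R s; nra.
have : p ^+ s * (1 + eps) ^+ s <= 1.
  by rewrite -exprMn exprn_ile1 //; nra.
have : 0 <= p ^+ s by rewrite exprn_ge0.
by nra.
Qed.

End Programs.

(** * Number of rounds and query bound *)

Lemma height_ln (R : realType) n : (0 < n)%N ->
  (height n)%:R * ln 2 ^+ 2 <= 2 * ln n.+1%:R ^+ 2 :> R.
Proof.
move=> n0; have l2 : 0 < ln 2 :> R by rewrite ln_gt0 // ltr1n.
have ln2n : ln 2 <= ln n.+1%:R :> R by rewrite ler_ln ?posrE ?ltr0n // ler_nat.
have : (height n).-1%:R * ln 2 <= ln n.+1%:R :> R.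
  rewrite mulr_natl -lnXn ?ltr0n // ler_ln ?posrE ?exprn_gt0 ?ltr0n //.
  by rewrite -natrX ler_nat ltnW // up_log_gtn.
have : (0 < height n)%N by rewrite up_log_gt0.
by case: (height n) => // k _ /=; rewrite -natr1; nra.
Qed.

Definition tester (R : realType) (n : nat) (eps : R) : alg R n :=
  if n is n'.+1 then rounds R n' (Num.truncn (2 / eps)).+1 else Ret R 0 true.

Lemma adaptive_upper_bound (R : realType) :
  exists C : R, 0 < C /\
     exists A : forall n : nat, R -> alg R n,
       forall (n : nat) (eps : R), 0 < eps < 1 ->
         ((2 <= n)%N ->
            exists q s : nat, within (A n eps) q s /\
              q%:R <= C * (ln (n%:R : R)) ^+ 2 / eps /\ s%:R <= C / eps) /\
         (forall (f : pt n -> R) (D : pt n -> R), is_distr D ->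
            (convex_fun f -> acc f D (A n eps) = 1) /\
            (far_wrt D eps f -> acc f D (A n eps) <= 1 / 3)).
Proof.
have l2 : 0 < ln 2 :> R by rewrite ln_gt0 // ltr1n.
have K0 : 0 < 216 / ln 2 ^+ 2 :> R by rewrite divr_gt0 // exprn_gt0.
(* [216 = 3 * 36 * 2]: at most [3 / eps] rounds, at most [36 * height n] queries in each, and the
   factor [2] of [height_ln]. The added [3] covers the samples. *)
exists (216 / ln 2 ^+ 2 + 3); split; first lra.
exists (@tester R) => n eps /[dup] e01 /andP[e0 e1].
case: n => [|n]; split=> //.
(* The empty grid carries no distribution. *)
- by move=> f D [_]; rewrite big1 => [/esym/eqP|[_ []]//]; rewrite oner_eq0.
- move=> n2; set s := (Num.truncn (2 / eps)).+1.
  have s3 : s%:R * eps <= 3.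
    have : (Num.truncn (2 / eps))%:R <= 2 / eps by rewrite truncn_le // divr_ge0 // ltW.
    by rewrite ler_pdivlMr // /s -natr1; nra.
  exists (s * (26 * height n + 10))%N, s; split; first exact: within_rounds.
  split; last by rewrite ler_pdivlMr //; lra.
  have := height_ln R n2; rewrite -ler_pdivlMr ?exprn_gt0 //.
  set t := (X in (height n)%:R <= X) => hl.
  have h1 : 1 <= (height n)%:R :> R by rewrite ler1n up_log_gt0.
  rewrite ler_pdivlMr // natrM natrD natrM [leLHS]mulrAC.
  apply: (@le_trans _ _ (3 * (36 * t))).
    by apply: ler_pM => //; [by rewrite mulr_ge0 // ltW | lra..].
  have : 0 <= ln n.+1%:R ^+ 2 :> R by rewrite sqr_ge0.
  by rewrite /t; lra.
- move=> f D dD; split; first exact: rounds_complete.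
  apply: rounds_sound => //.
  have : 2 / eps < (Num.truncn (2 / eps)).+1%:R by rewrite truncnS_gt.
  by rewrite ltr_pdivrMr // => /ltW.
Qed.

(** * Hard instances *)

Section LowerBound.
Variables (R : realType) (n L : nat).
Implicit Types (tau : nat) (sigma : {ffun 'I_L.+1 -> bool}) (x : pt n).

Definition level tau x : nat := x.2 + x.1 * tau.
Definition block tau x : nat := (level tau x)./2.
Definition middle x : bool := nat_of_ord x.1 == 1%N.

Definition bump (no : bool) tau sigma x : bool :=
  odd (level tau x) (+) sigma (inord (block tau x)) (+) (no && middle x).

Definition hard (no : bool) tau sigma x : R :=
  (level tau x)%:R ^+ 2 + (bump no tau sigma x)%:R.

(** The support is the tangent of the parabola at the level of [x], raised by the bump there. Points
    of one level share their bump; at any other level the parabola exceeds its tangent by at least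
    [1], which pays for the bump. *)
Lemma hard_convex tau sigma : convex_fun (hard false tau sigma).
Proof.
apply: supported_convex => x.
pose l : R := (level tau x)%:R.
have lE w : (level tau w)%:R = py R w + px R w * tau%:R.
  by rewrite /level natrD natrM.
have affE c w : aff c (2 * l * tau%:R) (2 * l) w = c + 2 * l * (level tau w)%:R.
  by rewrite /aff lE; ring.
exists (hard false tau sigma x - 2 * l ^+ 2), (2 * l * tau%:R), (2 * l).
split=> [|z]; rewrite affE -/l; first by ring.
have [e|ne] := eqVneq (level tau z) (level tau x).
  by rewrite /hard /bump /block e !andFb -/l; lra.
have sq : 1 <= ((level tau z)%:R - l) ^+ 2.
  rewrite /l; case: (ltngtP (level tau z) (level tau x)) ne => // lt _;
    rewrite -(ler_nat R) -natr1 in lt; nra.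
rewrite /hard -/l.
have := lern1 R (bump false tau sigma x); rewrite leq_b1.
have := ler0n R (bump false tau sigma z).
by nra.
Qed.

(** Each block from [tau] up to [n./2] contains a level with three equally spaced collinear points
    of which only the midpoint is raised. So [h] differs at one of them, and distinct blocks give
    distinct points. *)
Lemma hard_far tau sigma h : convex_fun h ->
  (n./2 - tau <= #|[pred x : pt n | hard true tau sigma x != h x]|)%N.
Proof.
move=> cvx_h.
rewrite -(size_iota tau (n./2 - tau)) cardE -(size_map (block tau)).
apply: uniq_leq_size; first exact: iota_uniq.
move=> k; rewrite mem_iota => /andP[le_tk lt_kn].
(* The element of the block [k] whose bump vanishes in the outer columns. *)
pose z : nat := k.*2 + sigma (inord k).
have zk : z./2 = k by rewrite /z; case: (sigma _); lia.
have zn : (z < n)%N by rewrite /z; case: (sigma _); lia.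
have zt : (tau.*2 <= z)%N by rewrite /z; case: (sigma _); lia.
have lt1 : (z - tau < n)%N by lia.
have lt2 : (z - tau.*2 < n)%N by lia.
pose p0 : pt n := (inord 0, Ordinal zn).
pose p1 : pt n := (inord 1, Ordinal lt1).
pose p2 : pt n := (inord 2, Ordinal lt2).
have l0 : level tau p0 = z by rewrite /level /= inordK //; lia.
have l1 : level tau p1 = z by rewrite /level /= inordK //; lia.
have l2 : level tau p2 = z by rewrite /level /= inordK //; lia.
have oz : odd z (+) sigma (inord k) = false.
  by rewrite /z; case: (sigma _); lia.
have hE p : level tau p = z -> hard true tau sigma p = z%:R ^+ 2 + (middle p)%:R.
  by move=> lp; rewrite /hard /bump /block lp zk oz.
have bE p : level tau p = z -> block tau p = k by move=> lp; rewrite /block lp.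
suff [p pn <-] : exists2 p, hard true tau sigma p != h p & block tau p = k.
  by apply: map_f; rewrite mem_enum.
have [e0|n0] := eqVneq (hard true tau sigma p0) (h p0); last first.
  by exists p0 => //; exact: bE.
have [e1|n1] := eqVneq (hard true tau sigma p1) (h p1); last first.
  by exists p1 => //; exact: bE.
have [e2|n2] := eqVneq (hard true tau sigma p2) (h p2); last first.
  by exists p2 => //; exact: bE.
have := @convex_cone R n h [:: (p0, 1); (p2, 1)] p1 2 cvx_h.
rewrite !big_cons !big_nil /= -e0 -e1 -e2 !hE // /middle /px /py /= !inordK //=.
rewrite !ler01 natrB ?natrB //; last lia.
rewrite -mul2n natrM => /(_ _ isT _ _ _).
have zz : (0:R) < 2 by [].
by move=> /(_ zz) H; have := H ltac:(ring) ltac:(ring) ltac:(ring); lra.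
Qed.

(** Levels in one block differ by at most one, so [tau] is within one of [y' - y] for [i = 0], and
    of [y - y'] for [i = 2]. *)
Lemma hard_collision_card (T y y' : nat) (i : 'I_3) : nat_of_ord i != 1%N ->
  (#|[pred tau : 'I_T | (y + tau)./2 == (y' + i * tau)./2]| <= 3)%N.
Proof.
move=> i1; pose c := if nat_of_ord i == 0%N then (y' - y)%N else (y - y')%N.
rewrite cardE -(size_map val).
apply: (@uniq_leq_size _ _ [:: c.-1; c; c.+1]).
  by rewrite map_inj_uniq ?enum_uniq //; exact: val_inj.
move=> t /mapP[tau]; rewrite mem_enum inE => /eqP e ->; rewrite /= /c !inE {c}.
by case: i i1 e => -[|[|[|i]]] //= _ _ e; lia.
Qed.

Definition collides tau q (Q : q.-tuple (pt n)) (j l : 'I_q) : bool :=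
  [&& middle (tnth Q j), ~~ middle (tnth Q l) &
      block tau (tnth Q j) == block tau (tnth Q l)].

(* Without a collision, flipping the bits of the blocks met in the middle column
   is a bijection of the seeds that turns one view into the other. *)
Lemma views_equal tau q (Q : q.-tuple (pt n)) (F : q.-tuple R -> R) :
  (forall x, (block tau x <= L)%N) ->
  (forall j l, ~~ collides tau Q j l) ->
  \sum_sigma F (map_tuple (hard true tau sigma) Q) =
  \sum_sigma F (map_tuple (hard false tau sigma) Q).
Proof.
move=> leL free.
pose hit (b : 'I_L.+1) :=
  [exists j, middle (tnth Q j) && (inord (block tau (tnth Q j)) == b)].
pose flip (sigma : {ffun 'I_L.+1 -> bool}) : {ffun 'I_L.+1 -> bool} :=
  [ffun b => sigma b (+) hit b].
have flipK : involutive flip.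
  by move=> s; apply/ffunP => b; rewrite !ffunE addbK.
rewrite [RHS](reindex_inj (inv_inj flipK)); apply: eq_bigr => s _.
congr F; apply: eq_from_tnth => l; rewrite !tnth_map /hard /bump.
congr (_ + (nat_of_bool _)%:R); rewrite addbF ffunE addbA; congr (_ (+) _).
rewrite /=; have [m|nm] := boolP (middle (tnth Q l)).
  by apply/esym/existsP; exists l; rewrite m eqxx.
apply/esym/negbTE/existsP => -[j /andP[mj /eqP/(congr1 val)]].
rewrite /= !inordK ?ltnS // => e.
by have := free j l; rewrite /collides mj nm e eqxx.
Qed.

Lemma collision_count (T q : nat) (Q : q.-tuple (pt n)) :
  (#|[pred tau : 'I_T | [exists j, exists l, collides tau Q j l]]| <= 3 * q ^ 2)%N.
Proof.
pose B (p : 'I_q * 'I_q) := [set tau : 'I_T | collides tau Q p.1 p.2].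
apply: (@leq_trans #|\bigcup_(p : 'I_q * 'I_q) B p|).
  apply: subset_leq_card; apply/subsetP => tau; rewrite inE.
  case/existsP => j /existsP[l cjl].
  by apply/bigcupP; exists (j, l); rewrite ?inE.
apply: (@leq_trans (\sum_(p : 'I_q * 'I_q) #|B p|)).
  elim/big_rec2: _ => [|p s A _ le_sA]; first by rewrite cards0.
  by rewrite (leq_trans (leq_card_setU _ _).1) // leq_add2l.
have cB p : (#|B p| <= 3)%N.
  have [m0|nm] := boolP (middle (tnth Q p.1) && ~~ middle (tnth Q p.2)); last first.
    rewrite (_ : B p = set0) ?cards0 //; apply/setP => tau; rewrite !inE.
    by apply/negbTE; apply: contra nm => /and3P[-> ->].
  have /andP[m1 m2] := m0.
  apply: leq_trans (hard_collision_card T (tnth Q p.1).2 (tnth Q p.2).2 m2).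
  apply: subset_leq_card; apply/subsetP => tau; rewrite !inE => /and3P[_ _].
  by rewrite /block /level (eqP m1) mul1n.
apply: leq_trans (leq_sum _ (fun p _ => cB p)) _.
by rewrite sum_nat_const card_prod card_ord mulnC mulnn.
Qed.

End LowerBound.

(** * Averaging over shifts and seeds *)

Lemma na_tester_queries (R : realType) (n q : nat) (eps : R)
    (mu : q.-tuple (pt n) -> R) (dec : q.-tuple (pt n) -> q.-tuple R -> R) :
  24 * eps <= 1 -> (8 <= n)%N -> is_na_tester eps mu dec ->
  ((n./2)./2 <= 9 * q ^ 2)%N.
Proof.
move=> eps24 n8 [mu0 mu1 dec01 yes no].
pose T := (n./2)./2; pose L := (3 * n)%N.
pose S : R := #|{: {ffun 'I_L.+1 -> bool}}|%:R.
pose bad Q (tau : 'I_T) := [exists j, exists l, @collides n tau q Q j l].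
pose gap tau sigma := na_acc mu dec (@hard R n L false tau sigma)
                      - na_acc mu dec (@hard R n L true tau sigma).
have S0 : 0 < S by rewrite ltr0n; apply/card_gt0P; exists [ffun => true].
have sumS (c : R) : \sum_(sigma : {ffun 'I_L.+1 -> bool}) c = c * S.
  by rewrite sumr_const mulr_natr.
have gap3 (tau : 'I_T) sigma : 1 / 3 <= gap tau sigma.
  have := yes _ (@hard_convex R n L tau sigma).
  suff /no : far_unif eps (@hard R n L true tau sigma) by rewrite /gap; lra.
  move=> h /(hard_far tau sigma); rewrite -(ler_nat R) => le_h.
  apply: le_trans le_h; rewrite card_prod !card_ord natrM.
  (* The grid has [3 * n] points and [24 * eps <= 1], so [n / 8] disagreements make the instance
     far. *)
  have : (n <= 8 * (n./2 - tau))%N by have := ltn_ord tau; rewrite /T; lia.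
  rewrite -(ler_nat R) natrM => le8.
  have : 0 <= n%:R :> R by [].
  by nra.
have lower : T%:R * S * (1 / 3) <= \sum_(tau < T) \sum_sigma gap tau sigma.
  apply: (@le_trans _ _ (\sum_(tau < T) \sum_(sigma : {ffun 'I_L.+1 -> bool}) (1/3))).
    under eq_bigr do rewrite sumS.
    by rewrite sumr_const card_ord -[leRHS]mulr_natl mulrAC -mulrA.
  by apply: ler_sum => tau _; apply: ler_sum => sigma _; exact: gap3.
have upper : \sum_(tau < T) \sum_sigma gap tau sigma <= 3 * q%:R ^+ 2 * S.
  (* The law of [Q] does not depend on the instance, so the shifts can be summed for a fixed [Q]. *)
  have -> : \sum_(tau < T) \sum_sigma gap tau sigma =
     \sum_Q mu Q * \sum_(tau < T)
       (\sum_sigma dec Q (map_tuple (@hard R n L false tau sigma) Q)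
        - \sum_sigma dec Q (map_tuple (@hard R n L true tau sigma) Q)).
    under eq_bigr => tau _ do under eq_bigr => sigma _ do
      rewrite /gap /na_acc -sumrB.
    under eq_bigr => tau _ do rewrite exchange_big.
    rewrite exchange_big; apply: eq_bigr => Q _ /=; rewrite mulr_sumr.
    apply: eq_bigr => tau _; rewrite -sumrB mulr_sumr.
    by apply: eq_bigr => sigma _; rewrite mulrBr.
  apply: (@le_trans _ _ (\sum_Q mu Q * (3 * q%:R ^+ 2 * S))); last first.
    by rewrite -mulr_suml mu1 mul1r.
  apply: ler_sum => Q _.
  apply: ler_wpM2l => //.
  apply: (@le_trans _ _ (\sum_(tau < T) (bad Q tau)%:R * S)).
    apply: ler_sum => tau _; have [b|nb] := boolP (bad Q tau).
      rewrite -sumS -sumrB -[true%:R]/(1 : R); apply: ler_sum => sigma _.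
      have /andP[_] := dec01 Q (map_tuple (@hard R n L false tau sigma) Q).
      have /andP[+ _] := dec01 Q (map_tuple (@hard R n L true tau sigma) Q).
      lra.
    rewrite mul0r views_equal ?subrr // => [x|j l].
      rewrite /block /level /L; have := ltn_ord tau; rewrite {2}/T.
      by case: x => -[[|[|[|i]]]] //= i3 [y lt_yn] /=; lia.
    by apply: contra nb => c; apply/existsP; exists j; apply/existsP; exists l.
  rewrite -mulr_suml; apply: ler_wpM2r; first exact: ltW.
  rewrite -natr_sum -natrX -natrM ler_nat.
  apply: leq_trans (collision_count T Q).
  by rewrite -sum1_card [leqRHS]big_mkcond /=; apply: leq_sum => tau _; rewrite inE.
rewrite -(ler_nat R) natrM natrX.
have := le_trans lower upper; rewrite mulrAC ler_pM2r // /T.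
by lra.
Qed.

Lemma na_lower_bound (R : realType) :
  exists eps0 : R, 0 < eps0 /\
     exists c : R, 0 < c /\
       exists N : nat, forall n : nat, (N <= n)%N ->
         forall (q : nat) (mu : q.-tuple (pt n) -> R)
                (dec : q.-tuple (pt n) -> q.-tuple R -> R),
           is_na_tester eps0 mu dec -> c * Num.sqrt (n%:R : R) <= q%:R.
Proof.
exists 24^-1; split; first by rewrite invr_gt0.
exists 9^-1; split; first by rewrite invr_gt0.
have e24 : 24 * 24^-1 <= 1 :> R by rewrite divff // pnatr_eq0.
exists 8%N => n n8 q mu dec /(na_tester_queries e24 n8) qn; rewrite ler_pdivrMl //.
have -> : 9 * q%:R = Num.sqrt ((9 * q%:R) ^+ 2) :> R.
  by rewrite sqrtr_sqr ger0_norm // mulr_ge0.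
rewrite ler_sqrt ?sqr_ge0 // -natrM -natrX ler_nat.
(* Here [n <= 36 * q ^ 2 + 3], and [8 <= n] forces [0 < q], so [81 * q ^ 2] is enough. *)
by nia.
Qed.

Theorem theorem1p5 (R : realType) :
  (exists C : R, 0 < C /\
     exists A : forall n : nat, R -> alg R n,
       forall (n : nat) (eps : R), 0 < eps < 1 ->
         ((2 <= n)%N ->
            exists q s : nat, within (A n eps) q s /\
              q%:R <= C * (ln (n%:R : R)) ^+ 2 / eps /\ s%:R <= C / eps) /\
         (forall (f : pt n -> R) (D : pt n -> R), is_distr D ->
            (convex_fun f -> acc f D (A n eps) = 1) /\
            (far_wrt D eps f -> acc f D (A n eps) <= 1 / 3)))
  /\
  (exists eps0 : R, 0 < eps0 /\
     exists c : R, 0 < c /\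
       exists N : nat, forall n : nat, (N <= n)%N ->
         forall (q : nat) (mu : q.-tuple (pt n) -> R)
                (dec : q.-tuple (pt n) -> q.-tuple R -> R),
           is_na_tester eps0 mu dec -> c * Num.sqrt (n%:R : R) <= q%:R).
Proof. by split; [exact: adaptive_upper_bound | exact: na_lower_bound]. Qed.
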